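(* Fix a real number $\epsilon> 0$ and a group-theoretic property $\mathcal{P}$ such that: (i) $\mathcal{P}$ is closed under taking subgroups and quotients; (ii) there exist constants $\delta>0$ and $\gamma$ (depending on $\mathcal{P}$) such that for all integers $n>0$ there exists a (possibly empty) set $\mathcal{C}_n$ of transitive subgroups of $\mathrm{S}_n$, each of order at most $2^{\delta n}$, and lying in at most $2^{\gamma n}$ conjugacy classes of $\mathrm{S}_n$, such that each transitive $\mathcal{P}$-subgroup of $\mathrm{S}_n$ is a subgroup of at least one group in $\mathcal{C}_n$; (iii) there exists a constant $C$ such that for all $n \ge 1$, if $G \le \mathrm{S}_n$ is a $\mathcal{P}$-group with all non-trivial orbits of length at least $C$, then $d(G) \le \epsilon n/\delta$. Let $f: \mathbb{Z}_{\ge 0} \rightarrow \mathbb{R}_{\ge 0}$ be a non-decreasing function such that for all partitions $n = n_1 + \cdots + n_t$ with $n_i < C$ for each $i$, and all groups $H_i \in \mathcal{C}_{n_i}$, we have $|\mathrm{Sub}_{\mathcal{P}}(H_1 \times \cdots \times H_t)| \le 2^{\epsilon n^2 + f(n)}$. Then for all integers $n\geq 2$ \[|\mathrm{Sub}_{\mathcal{P}}(\mathrm{S}_n)|\le 2^{\epsilon n^2+f(n)+n\log n+\gamma n+ 4 \sqrt{n}} \leq 2^{\epsilon n^2 + f(n) + (5 + \gamma) n \log n}.\]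
   Context: $\mathrm{S}_n$ is the symmetric group on $n$ points. A $\mathcal{P}$-group is a group satisfying $\mathcal{P}$, and $\mathrm{Sub}_{\mathcal{P}}(G)$ is the set of subgroups of $G$ satisfying $\mathcal{P}$. $d(G)$ is the minimal number of generators of $G$. An orbit is non-trivial if it has length greater than $1$. Logarithms are to the base $2$.
   Formalization: The property P is assumed to be satisfied by the trivial group; this excludes only the empty property, for which one may take all C_n empty and γ very negative, so that the second inequality fails (e.g. n = 3, γ = -100). *)

(* Defs.v *)
From HB Require Import structures.
From mathcomp Require Import all_boot all_order all_algebra all_fingroup all_solvable.
From mathcomp Require Import boolp reals exp.

Set Implicit Arguments.
Unset Strict Implicit.
Unset Printing Implicit Defensive.

Import Order.TTheory GRing.Theory Num.Theory.

Local Open Scope group_scope.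

Definition group_pred := forall gT : finGroupType, {group gT} -> Prop.

(* As usual for a group-theoretic property, the trivial group is assumed to
   satisfy P.  Given closure under quotients this only excludes the empty
   property, for which every gamma, however negative, would be admissible. *)
Definition group_theoretic (P : group_pred) : Prop :=
  (forall (gT rT : finGroupType) (G : {group gT}) (H : {group rT}),
      G \isog H -> P gT G -> P rT H)
  /\ (forall gT : finGroupType, P gT 1%G).

Definition subgroup_closed (P : group_pred) : Prop :=
  forall (gT : finGroupType) (G H : {group gT}), H \subset G -> P gT G -> P gT H.

Definition quotient_closed (P : group_pred) : Prop :=
  forall (gT : finGroupType) (G N : {group gT}),
    N <| G -> P gT G -> P (coset_of N) (G / N)%G.

Definition P_subgroups (P : group_pred) (gT : finGroupType) (G : {group gT}) :
    {set {group gT}} :=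
  [set H : {group gT} | (H \subset G) && `[< P gT H >]].

Definition transitive_group (n : nat) (G : {group {perm 'I_n}}) : bool :=
  [transitive G, on [set: 'I_n] | 'P].

Definition conj_classes (n : nat) (A : {set {group {perm 'I_n}}}) :
    {set {set {set {perm 'I_n}}}} :=
  [set H :^: [set: {perm 'I_n}] | H : {group {perm 'I_n}} in A].

Definition log2 (R : realType) (x : R) : R := (ln x / ln 2)%R.

(* Main.v *)
(* A P-subgroup G of Sym(n) embeds in the product of its transitive constituents, hence in a
   product M of groups H_i from the sets CC n_i, one for each orbit. The orbits and an
   enumeration of each are encoded by a map from the n points to themselves sending every
   point to its predecessor in its orbit, which leaves at most n^n choices; the classes of
   the H_i leave 2^(gamma n) more.

   For fixed M, let a points lie in orbits of length less than C and b = n - a in the others,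
   and let psi be the action on the latter. Then G is generated by its intersection with the
   kernel of psi, which embeds in the product of the H_i of degree less than C and so can be
   chosen in 2^(eps a^2 + f a) ways, and by lifts to M of at most eps b / delta generators of
   psi(G). As |M| <= 2^(delta n), there are at most 2^(eps n b) choices of the lifts, and
   a^2 + n b <= n^2. *)
Require Import Defs.
From HB Require Import structures.
From mathcomp Require Import all_boot all_order all_algebra all_fingroup all_solvable.
From mathcomp Require Import boolp reals exp ring lra.

Set Implicit Arguments.
Unset Strict Implicit.
Unset Printing Implicit Defensive.

Import Order.TTheory GRing.Theory Num.Theory.

Section PullBack.
Local Open Scope group_scope.
Variables S T : finType.
Implicit Types (e : S -> T) (g : {perm T}) (h : {perm S}).

(* For injective [e], [liftable e] is the stabiliser of the image of [e], and [pull e]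
   is its action on that image, transported to [S]. *)
Definition liftable e : {set {perm T}} :=
  [set g : {perm T} | [exists h : {perm S}, [forall x, e (h x) == g (e x)]]].

Definition pull e (g : {perm T}) : {perm S} :=
  odflt 1 [pick h : {perm S} | [forall x, e (h x) == g (e x)]].

Lemma pullE e g x : g \in liftable e -> e (pull e g x) = g (e x).
Proof.
rewrite inE /pull => /existsP[h hP]; case: pickP => [h' /forallP/(_ x)/eqP // | /(_ h)].
by rewrite hP.
Qed.

Lemma liftableI e g h : (forall x, e (h x) = g (e x)) -> g \in liftable e.
Proof. by move=> hg; rewrite inE; apply/existsP; exists h; apply/forallP => x; rewrite hg. Qed.

Lemma pull_uniq e g h :
  injective e -> (forall x, e (h x) = g (e x)) -> pull e g = h.
Proof.
move=> inj_e hg; apply/permP => x; apply: inj_e; rewrite pullE ?hg //.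
exact: liftableI hg.
Qed.

Lemma liftable_codom e g :
  injective e -> (forall x, g (e x) \in codom e) -> g \in liftable e.
Proof.
move=> inj_e ge; have hP x : e (iinv (ge x)) = g (e x) by rewrite f_iinv.
have inj_h : injective (fun x => iinv (ge x)).
  by move=> x y /(congr1 e); rewrite !hP => /perm_inj/inj_e.
by apply: (@liftableI _ _ (perm inj_h)) => x; rewrite permE.
Qed.

Lemma liftable_group_set e : group_set (liftable e).
Proof.
apply/group_setP; split=> [|g g' lg lg'].
  by apply: (@liftableI _ _ 1) => x; rewrite !perm1.
by apply: (@liftableI _ _ (pull e g * pull e g')) => x; rewrite !permM !pullE.
Qed.
Canonical liftable_group e := Group (liftable_group_set e).

Lemma pullM e : injective e -> {in liftable e &, {morph pull e : g g' / g * g'}}.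
Proof.
by move=> inj_e g g' lg lg'; apply: pull_uniq => // x; rewrite !permM !pullE.
Qed.

Definition pull_morphism e (inj_e : injective e) := Morphism (pullM inj_e).

Lemma orbit_pull e (inj_e : injective e) (G : {group {perm T}}) x :
  G \subset liftable e ->
  orbit 'P G (e x) = e @: orbit 'P (pull_morphism inj_e @* G) x.
Proof.
move=> sGe; rewrite morphimEsub //.
apply/setP => y; apply/orbitP/imsetP => [[g Gg <-] | [z /orbitP[h /imsetP[g Gg ->]] <- ->]].
  exists (pull e g x); last by rewrite pullE ?(subsetP sGe).
  by apply/orbitP; exists (pull e g); rewrite ?imset_f.
by exists g => //=; rewrite /aperm pullE ?(subsetP sGe).
Qed.

End PullBack.

Section PullBackProduct.
Local Open Scope group_scope.
Variables (I T : finType) (S : I -> finType) (e : forall i, S i -> T).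
Arguments e : clear implicits.
Hypothesis inj_e : forall i, injective (e i).

Definition pulls (g : {perm T}) : {dffun forall i, {perm S i}} :=
  [ffun i => pull (e i) g].

Definition liftables := \bigcap_i liftable_group (e i).

Lemma pullsM : {in liftables &, {morph pulls : g g' / g * g'}}.
Proof.
move=> g g' /bigcapP lg /bigcapP lg'; apply/ffunP => i.
by rewrite !ffunE pullM // ?lg ?lg'.
Qed.
Canonical pulls_morphism := Morphism pullsM.
End PullBackProduct.

Section Properties.
Local Open Scope group_scope.
Variable P : group_pred.
Arguments P : clear implicits.
Hypotheses (P_prop : group_theoretic P) (P_quo : quotient_closed P).

Lemma P_morphim (aT rT : finGroupType) (D G : {group aT}) (f : {morphism D >-> rT}) :
  G \subset D -> P _ G -> P _ (f @* G)%G.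
Proof.
move=> sGD PG; have [P_iso _] := P_prop.
apply: (P_iso _ _ (G / 'ker_G f)%G); last by apply: P_quo => //; rewrite /normal subsetIl normsI ?normG // (subset_trans sGD) ?ker_norm.
exact: first_isog_loc.
Qed.
End Properties.

Section SubgroupCounting.
Local Open Scope group_scope.
Variables (aT rT : finGroupType) (D : {group aT}) (f : {morphism D >-> rT}).
Implicit Types (F : {set {group aT}}).

Lemma subset_morphim_ker (G H : {group aT}) :
  G \subset D -> H \subset G -> G :&: 'ker f \subset H -> f @* G \subset f @* H ->
  G \subset H.
Proof.
move=> sGD sHG sKH sfGH; apply/subsetP => x Gx.
have Dx := subsetP sGD x Gx; have sHD := subset_trans sHG sGD.
have: f x \in f @* H by rewrite (subsetP sfGH) ?mem_morphim.
case/morphimP => y Dy Hy eq_xy; rewrite -(mulgKV y x) groupM //.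
apply: (subsetP sKH); rewrite in_setI groupM ?groupV ?(subsetP sHG y) //=.
by apply/kerP; rewrite ?groupM ?groupV // morphM ?groupV // morphV // eq_xy mulgV.
Qed.

Lemma card_subgroups_gens F (M : {group aT}) d :
    (forall G : {group aT}, G \in F ->
       [/\ G \subset M, G \subset D & 'm(f @* G) <= d]%N) ->
  (#|F| <= #|[set (G :&: 'ker f)%G | G : {group aT} in F]| * #|M| ^ d)%N.
Proof.
move=> FP.
pose N := [set (G :&: 'ker f)%G | G : {group aT} in F].
pose X := [set t : {ffun 'I_d -> aT} | t \in ffun_on (mem M)].
have cX : #|X| = (#|M| ^ d)%N by rewrite cardsE card_ffun_on card_ord.
rewrite -cX -cardsX.
pose h (p : {group aT} * {ffun 'I_d -> aT}) := <<p.1 :|: [set p.2 i | i : 'I_d]>>%G.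
suff sF : F \subset h @: setX N X by apply: leq_trans (leq_imset_card h _); apply: subset_leq_card.
apply/subsetP => G FG; have [sGM sGD dG] := FP G FG.
have [B genB cB] := grank_witness (f @* G)%G.
have sBG : B \subset f @* G by rewrite -genB subset_gen.
pose t := [ffun i : 'I_d => repr (G :&: f @*^-1 [set nth 1 (enum B) i])].
have tP i : t i \in G /\ ((i < #|B|)%N -> f (t i) = nth 1 (enum B) i).
  rewrite ffunE; set b := nth _ _ _.
  have : b \in f @* G.
    rewrite /b; have [lti|gei] := ltnP i #|B|.
      by rewrite (subsetP sBG) // -mem_enum mem_nth // -cardE.
    by rewrite nth_default ?group1 // -cardE.
  case/morphimP => x Dx Gx def_b.
  have /mem_repr : x \in G :&: f @*^-1 [set b] by rewrite !inE Gx Dx def_b eqxx.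
  by case/setIP => -> /morphpreP[_ /set1P ->].
apply/imsetP; exists ((G :&: 'ker f)%G, t).
  rewrite in_setX (imset_f (fun G => 'ker_G f)%G FG) /= inE; apply/ffun_onP => i.
  by rewrite (subsetP sGM) // (tP i).1.
have sHG : <<(G :&: 'ker f) :|: [set t i | i : 'I_d]>> \subset G.
  rewrite gen_subG subUset subsetIl /=; apply/subsetP => _ /imsetP[i _ ->].
  exact: (tP i).1.
apply/val_inj/eqP; rewrite /= eqEsubset sHG andbT.
apply: subset_morphim_ker => //; first by rewrite (subset_trans _ (subset_gen _)) ?subsetUl.
rewrite -genB gen_subG; apply/subsetP => b Bb.
have ltb : (index b (enum B) < #|B|)%N by rewrite cardE index_mem mem_enum.
have ltd : (index b (enum B) < d)%N by rewrite (leq_trans ltb) // cB.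
pose i := Ordinal ltd.
have <- : f (t i) = b by rewrite (tP i).2 //= nth_index ?mem_enum.
by rewrite mem_morphim ?(subsetP sGD) ?(tP i).1 // mem_gen // inE imset_f ?orbT.
Qed.

Variable P : group_pred.
Arguments P : clear implicits.
Hypotheses (P_prop : group_theoretic P) (P_quo : quotient_closed P).

Lemma card_P_subgroups_inj F (K : {group aT}) (M : {group rT}) :
    K \subset D -> K :&: 'ker f \subset [1] ->
    (forall G : {group aT}, G \in F -> [/\ P _ G, G \subset K & f @* G \subset M]) ->
  (#|F| <= #|P_subgroups P M|)%N.
Proof.
move=> sKD injK FP; pose h (G : {group aT}) := (f @* G)%G.
have h_inj : {in F &, injective h}.
  have half (G H : {group aT}) : G \in F -> H \in F -> h G = h H -> G \subset H.
    move=> /FP[_ sGK _] /FP[_ sHK _] /(congr1 val)/= eqf.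
    have: G <*> H \subset H; last by apply: subset_trans; rewrite joing_subl.
    have sJK : G <*> H \subset K by rewrite join_subG sGK.
    apply: subset_morphim_ker; rewrite ?joing_subr //.
    - exact: subset_trans sJK sKD.
    - by rewrite (subset_trans (setSI _ sJK)) // (subset_trans injK) // sub1G.
    - by rewrite /= morphimY ?(subset_trans _ sKD) // join_subG eqf subxx.
  by move=> G H FG FH eqh; apply/val_inj/eqP; rewrite eqEsubset !half.
rewrite -(card_in_imset h_inj); apply/subset_leq_card/subsetP => _ /imsetP[G FG ->].
have [PG sGK sGM] := FP G FG; rewrite inE sGM /=; apply/asboolP.
by apply: P_morphim => //; apply: subset_trans sGK sKD.
Qed.
End SubgroupCounting.

Section BlockSystem.
Local Open Scope group_scope.
Variables (n : nat) (I : finType) (n_ : I -> nat) (e : forall i, 'I_(n_ i) -> 'I_n).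
Arguments e : clear implicits.
Variable lab : 'I_n -> I.
Hypothesis inj_e : forall i, injective (e i).
Hypothesis lab_e : forall i y, lab (e i y) = i.
Hypothesis e_onto : forall x, exists y, e (lab x) y = x.

Lemma card_block i : #|[set x | lab x == i]| = n_ i.
Proof.
suff -> : [set x | lab x == i] = [set e i y | y : 'I_(n_ i)].
  by rewrite (card_imset _ (@inj_e i)) card_ord.
apply/setP => x; rewrite inE; apply/eqP/imsetP => [<- | [y _ ->] //].
by have [y ey] := e_onto x; exists y.
Qed.

Lemma sum_block (A : {set I}) : (\sum_(i in A) n_ i)%N = #|[set x | lab x \in A]|.
Proof.
rewrite -sum1_card (partition_big lab (mem A)) => [|x]; last by rewrite inE.
apply: eq_bigr => i Ai; rewrite -card_block -sum1_card; apply: eq_bigl => x.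
by rewrite !inE; case: eqP => [->|]; rewrite ?Ai ?andbF.
Qed.

Lemma sum_block_all : (\sum_i n_ i)%N = n.
Proof.
rewrite -[RHS]card_ord -cardsT; have <- : [set x | lab x \in [set: I]] = setT.
  by apply/setP => x; rewrite !inE.
by rewrite -sum_block; apply: eq_bigl => i; rewrite inE.
Qed.

Lemma liftable_block (G : {group {perm 'I_n}}) i :
  (forall x, orbit 'P G x = [set y | lab y == lab x]) -> G \subset liftable (e i).
Proof.
move=> oG; apply/subsetP => g Gg; apply: liftable_codom => [|y]; first exact: inj_e.
have := mem_orbit 'P (e i y) Gg; rewrite oG inE lab_e /= /aperm => /eqP eq_lab.
have [z ez] := e_onto (g (e i y)).
by move: z ez; rewrite eq_lab => z <-; apply: codom_f.
Qed.

Definition block_product (H : forall i, {group {perm 'I_(n_ i)}}) : {group {perm 'I_n}} :=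
  (pulls_morphism inj_e @*^-1 setXn H)%G.

Lemma card_block_product H : (#|block_product H| <= \prod_i #|H i|)%N.
Proof.
have injp : 'injm (pulls_morphism inj_e).
  apply/subsetP => g /morphpreP[lg /set1P pg]; apply/set1P/permP => x.
  have [y ey] := e_onto x; rewrite perm1.
  have /ffunP/(_ (lab x)) := pg; rewrite ffunE oneg_ffun => pgx.
  by rewrite -{1}ey -pullE ?pgx ?perm1 ?(bigcapP lg).
have sMD : block_product H \subset liftables e by apply: subsetIl.
by rewrite -cardsXn -(card_injm injp sMD) subset_leq_card // sub_morphim_pre.
Qed.

End BlockSystem.

Section TwoPow.
Local Open Scope ring_scope.
Variable R : realType.

Lemma pow2D (x y : R) : 2 `^ (x + y) = 2 `^ x * 2 `^ y.
Proof. by rewrite powRD // pnatr_eq0 implybT. Qed.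

Lemma pow2_prod (I : finType) (A : {pred I}) (x : I -> R) :
  \prod_(i in A) 2 `^ x i = 2 `^ (\sum_(i in A) x i).
Proof. by apply/esym/(big_morph (fun y => 2 `^ y)); [exact: pow2D | exact: powRr0]. Qed.

Lemma ler_pow2 (x y : R) : x <= y -> 2 `^ x <= 2 `^ y.
Proof. by apply: ler_powR; rewrite ler1n. Qed.

End TwoPow.

Section FixedBlocks.
Local Open Scope group_scope.
Local Open Scope ring_scope.
Variables (R : realType) (eps : R) (P : group_pred)
    (delta C : R) (CC : forall n : nat, {set {group {perm 'I_n}}})
    (f : nat -> R).
Arguments P : clear implicits.
Hypotheses (eps_gt0 : 0 < eps) (P_prop : group_theoretic P)
    (P_sub : subgroup_closed P) (P_quo : quotient_closed P)
    (delta_gt0 : 0 < delta)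
    (CC_order : forall (n : nat) (H : {group {perm 'I_n}}),
        (0 < n)%N -> H \in CC n -> (#|H|%:R : R) <= 2 `^ (delta * n%:R))
    (d_bound : forall (n : nat) (G : {group {perm 'I_n}}),
        (1 <= n)%N -> P _ G ->
        (forall x : 'I_n, (1 < #|orbit 'P G x|)%N -> C <= #|orbit 'P G x|%:R) ->
        ('m(G)%g)%:R <= eps * n%:R / delta)
    (f_mono : forall m n : nat, (m <= n)%N -> f m <= f n)
    (f_bound : forall (n t : nat) (n_ : 'I_t -> nat)
        (H : forall i : 'I_t, {group {perm 'I_(n_ i)}}),
        (forall i, (0 < n_ i)%N) ->
        (forall i, (n_ i)%:R < C) ->
        n = (\sum_(i < t) n_ i)%N ->
        (forall i, H i \in CC (n_ i)) ->
        (#|P_subgroups P (setXn_group H)|%:R : R) <= 2 `^ (eps * n%:R ^+ 2 + f n)).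

Variables (n : nat) (I : finType) (n_ : I -> nat) (e : forall i, 'I_(n_ i) -> 'I_n).
Arguments e : clear implicits.
Variable lab : 'I_n -> I.
Variable H : forall i, {group {perm 'I_(n_ i)}}.
Hypotheses (inj_e : forall i, injective (e i)) (lab_e : forall i y, lab (e i y) = i)
  (e_onto : forall x, exists y, e (lab x) y = x)
  (n_gt0 : forall i, (0 < n_ i)%N) (H_CC : forall i, H i \in CC (n_ i)).

Lemma card_setXn_CC : (#|block_product inj_e H|%:R : R) <= 2 `^ (delta * n%:R).
Proof.
apply: (@le_trans _ _ (\prod_i #|H i|)%:R).
  by rewrite ler_nat (card_block_product inj_e e_onto).
rewrite natr_prod -(sum_block_all inj_e lab_e e_onto) natr_sum mulr_sumr -pow2_prod.
by apply: ler_prod => i _; rewrite ler0n CC_order.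
Qed.

Let S := [set i | (n_ i)%:R < C].
Let L := [set x | lab x \notin S].
Let a := #|[set x | lab x \in S]|.
Let b := #|L|.
Let inj_eL : injective (enum_val : 'I_b -> 'I_n) := @enum_val_inj _ _.
Let psi := pull_morphism inj_eL.
Let e' (j : 'I_#|S|) := e (enum_val j).
Arguments e' : clear implicits.
Let inj_e' j : injective (e' j) := @inj_e (enum_val j).
Let H' (j : 'I_#|S|) := H (enum_val j).

Lemma card_small_large : (a + b = n)%N.
Proof.
rewrite /a /b -[RHS](card_ord n) -(cardC [set x | lab x \in S]); congr (_ + _)%N.
by apply: eq_card => x; rewrite !inE.
Qed.

Lemma card_small_product :
  (#|P_subgroups P (setXn_group H')|%:R : R) <= 2 `^ (eps * a%:R ^+ 2 + f n).
Proof.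
apply: (@le_trans _ _ (2 `^ (eps * a%:R ^+ 2 + f a))).
  apply: f_bound => [j|j||j]; [exact: n_gt0 | | | exact: H_CC].
    by have := enum_valP j; rewrite inE.
  rewrite /a -(sum_block inj_e lab_e e_onto).
  by rewrite big_enum_val.
by apply: ler_pow2; rewrite lerD2l f_mono // -card_small_large leq_addr.
Qed.

Variable F : {set {group {perm 'I_n}}}.
Hypotheses (F_P : forall G : {group {perm 'I_n}}, G \in F -> P _ G)
  (F_orbit : forall G : {group {perm 'I_n}}, G \in F ->
     forall x, orbit 'P G x = [set y | lab y == lab x])
  (F_H : forall G : {group {perm 'I_n}}, G \in F ->
     forall i, {in G, forall g, pull (e i) g \in H i}).

Lemma F_block (G : {group {perm 'I_n}}) : G \in F -> G \subset block_product inj_e H.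
Proof.
move=> FG; apply/subsetP => g Gg.
have lg i : g \in liftable (e i).
  exact: (subsetP (liftable_block inj_e lab_e e_onto i (F_orbit FG))).
apply/morphpreP; split; first by apply/bigcapP => i _; apply: lg.
by apply/setXnP => i; rewrite ffunE (F_H FG).
Qed.

Lemma F_large (G : {group {perm 'I_n}}) : G \in F -> G \subset liftable (enum_val : 'I_b -> 'I_n).
Proof.
move=> FG; apply/subsetP => g Gg; apply: liftable_codom => [|y]; first exact: enum_val_inj.
have Lgy : g (enum_val y) \in L.
  have := mem_orbit 'P (enum_val y) Gg; rewrite (F_orbit FG) in_set => /eqP eq_lab.
  by have := enum_valP y; rewrite !in_set -eq_lab.
by apply/codomP; exists (enum_rank_in Lgy (g (enum_val y))); rewrite enum_rankK_in.
Qed.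

Lemma rank_large (G : {group {perm 'I_n}}) :
  G \in F -> ('m(psi @* G)%g)%:R <= eps * b%:R / delta.
Proof.
move=> FG; have sGl := F_large FG.
have [b0|b_gt0] := posnP b.
  suff -> : 'm(psi @* G) = 0%N by rewrite !mulr_ge0 ?invr_ge0 ?ler0n // ltW.
  have -> : psi @* G = <<set0>>.
    rewrite gen0; apply/trivgP/subsetP => g _; apply/set1P/permP => x.
    by have := ltn_ord x; rewrite [X in (_ < X)%N]b0.
  by apply/eqP; rewrite -leqn0 -(cards0 {perm 'I_b}) grank_min.
apply: d_bound => //; first exact: P_morphim (F_P FG).
move=> x _; rewrite -(card_imset _ inj_eL) -orbit_pull // (F_orbit FG).
rewrite (card_block inj_e lab_e e_onto).
by have := enum_valP x; rewrite !inE -leNgt.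
Qed.

Lemma card_small_kernel :
  (#|[set (G :&: 'ker psi)%G | G : {group {perm 'I_n}} in F]|%:R : R)
    <= 2 `^ (eps * a%:R ^+ 2 + f n).
Proof.
apply: le_trans card_small_product; rewrite ler_nat.
pose K := ((\bigcap_j liftable_group (e' j)) :&: 'ker psi)%G.
apply: (card_P_subgroups_inj (f := pulls_morphism inj_e') P_prop P_quo (K := K)).
- exact: subsetIl.
- apply/subsetP => g /setIP[/setIP[lg kg] /morphpreP[_ /set1P pg]].
  apply/set1P/permP => x; rewrite perm1.
  have [Sx|Lx] := boolP (lab x \in S).
    have [y ey] := e_onto x; set j := enum_rank_in Sx (lab x).
    have ej : enum_val j = lab x by rewrite enum_rankK_in.
    move: y ey; rewrite -ej => y ey; rewrite -ey -[e _ _]/(e' j y) -pullE ?(bigcapP lg) //.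
    by have /ffunP/(_ j) := pg; rewrite ffunE oneg_ffun => ->; rewrite perm1.
  have Lx' : x \in L by rewrite inE.
  have ex : enum_val (enum_rank_in Lx' x) = x by rewrite enum_rankK_in.
  case/morphpreP: kg => lLg /set1P pLg.
  by rewrite -{1}ex -(pullE _ lLg) [pull _ _]pLg perm1.
move=> _ /imsetP[G FG ->]; have sGM := F_block FG; split.
- by apply: P_sub (F_P FG); apply: subsetIl.
- rewrite setSI //; apply/subsetP => g Gg; apply/bigcapP => j _.
  by have := subsetP sGM g Gg; rewrite inE => /andP[/bigcapP/(_ (enum_val j) isT)].
apply/subsetP => _ /morphimP[g _ /setIP[Gg _] ->]; apply/setXnP => j.
have /morphpreP[_ /setXnP/(_ (enum_val j))] := subsetP sGM g Gg.
by rewrite !ffunE.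
Qed.

Lemma card_fixed_blocks : (#|F|%:R : R) <= 2 `^ (eps * n%:R ^+ 2 + f n).
Proof.
pose x := eps * b%:R / delta.
have x_ge0 : 0 <= x by rewrite !mulr_ge0 ?invr_ge0 ?ler0n // ltW.
apply: (@le_trans _ _
  (#|[set (G :&: 'ker psi)%G | G : {group {perm 'I_n}} in F]|
     * #|block_product inj_e H| ^ Num.truncn x)%:R).
  rewrite ler_nat; apply: card_subgroups_gens => G FG.
  by rewrite F_block // F_large // truncn_ge_nat // rank_large.
rewrite natrM natrX.
apply: (@le_trans _ _ (2 `^ (eps * a%:R ^+ 2 + f n) * 2 `^ (eps * n%:R * b%:R))).
  apply: ler_pM; rewrite ?ler0n ?exprn_ge0 ?card_small_kernel //.
  apply: (@le_trans _ _ ((2 `^ (delta * n%:R)) ^+ Num.truncn x)).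
    by apply: lerXn2r; rewrite ?nnegrE ?powR_ge0 ?ler0n ?card_setXn_CC.
  rewrite -powR_mulrn ?powR_ge0 // -powRrM; apply: ler_pow2.
  have -> : eps * n%:R * b%:R = delta * n%:R * x.
    by rewrite /x; field; rewrite gt_eqF.
  by rewrite ler_wpM2l ?mulr_ge0 ?ler0n ?truncn_le // ltW.
have le_ab : (a ^ 2 + n * b <= n ^ 2)%N.
  by rewrite -card_small_large -!mulnn [leqRHS]mulnDr leq_add // leq_mul ?leq_addr.
rewrite -pow2D; apply: ler_pow2; rewrite addrAC lerD2r -mulrA -mulrDr.
by rewrite ler_wpM2l ?(ltW eps_gt0) // -!natrX -natrM -natrD ler_nat.
Qed.
End FixedBlocks.

Section OrbitCoding.
Variable n : nat.
Implicit Types (p : {ffun 'I_n -> 'I_n} * {ffun 'I_n -> 'I_n}) (x y : 'I_n).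

Definition block p (rho : 'I_n) : {set 'I_n} := [set y | p.1 y == rho].

(* [p.1 x] is the first point of the orbit of [x] and [p.2 x] the position of [x] in an
   enumeration of that orbit. *)
Definition orbit_coding p : bool :=
  [&& injectiveb (fun x => (p.1 x, p.2 x)),
      [forall x, (p.2 x < #|block p (p.1 x)|)%N]
    & [forall x, (p.1 (p.1 x) == p.1 x) && (p.2 (p.1 x) == 0 :> nat)]].

Definition coding_point p (rho : 'I_n) (j : nat) : 'I_n :=
  odflt rho [pick y | (p.1 y == rho) && (p.2 y == j :> nat)].

Lemma coding_inj p : orbit_coding p ->
  forall x y, p.1 x = p.1 y -> p.2 x = p.2 y :> nat -> x = y.
Proof.
case/and3P => /injectiveP inj_p _ _ x y eq1 eq2; apply: inj_p.
by rewrite eq1; congr (_, _); apply: val_inj.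
Qed.

Lemma coding_lt p x : orbit_coding p -> (p.2 x < #|block p (p.1 x)|)%N.
Proof. by case/and3P => _ /forallP. Qed.

Lemma coding_root p x : orbit_coding p ->
  p.1 (p.1 x) = p.1 x /\ p.2 (p.1 x) = 0 :> nat.
Proof. by case/and3P => _ _ /forallP/(_ x)/andP[/eqP-> /eqP->]. Qed.

Lemma coding_pointE p x : orbit_coding p -> coding_point p (p.1 x) (p.2 x) = x.
Proof.
move=> cp; rewrite /coding_point; case: pickP => [y /andP[/eqP e1 /eqP e2]|/(_ x)].
  exact: coding_inj cp _ _ e1 e2.
by rewrite !eqxx.
Qed.

Lemma coding_pointP p rho j : orbit_coding p -> (j < #|block p rho|)%N ->
  p.1 (coding_point p rho j) = rho /\ p.2 (coding_point p rho j) = j :> nat.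
Proof.
move=> cp ltj; rewrite /coding_point; case: pickP => [y /andP[/eqP -> /eqP ->] //|no_y].
pose s := [seq p.2 y : nat | y <- enum (block p rho)].
have s_uniq : uniq s.
  rewrite map_inj_in_uniq ?enum_uniq // => y z; rewrite !mem_enum !inE => /eqP e1 /eqP e2.
  by apply: coding_inj; rewrite ?e1.
have s_sub : {subset s <= iota 0 #|block p rho|}.
  move=> _ /mapP[y + ->]; rewrite mem_enum inE mem_iota => /eqP <-.
  by rewrite coding_lt.
have [] := uniq_min_size s_uniq s_sub; first by rewrite size_map -cardE size_iota.
move=> _ /(_ j); rewrite mem_iota /= ltj => /mapP[y + ej].
by rewrite mem_enum inE => yr; have := no_y y; rewrite yr ej eqxx.
Qed.

Definition predecessor p : {ffun 'I_n -> 'I_n} :=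
  [ffun x => if p.2 x == 0 :> nat then x else coding_point p (p.1 x) (p.2 x).-1].

Lemma predecessorP p x : orbit_coding p -> (0 < p.2 x)%N ->
  p.1 (predecessor p x) = p.1 x /\ (p.2 (predecessor p x)).+1 = p.2 x.
Proof.
move=> cp k_gt0; rewrite ffunE -leqn0 leqNgt k_gt0 /=.
have [|-> ->] := @coding_pointP p (p.1 x) (p.2 x).-1 cp; last by rewrite prednK.
by rewrite (leq_ltn_trans (leq_pred _)) ?coding_lt.
Qed.

Lemma predecessor_fix p x : orbit_coding p -> (predecessor p x == x) = (p.2 x == 0 :> nat).
Proof.
move=> cp; have [k0|k_gt0] := posnP (p.2 x); first by rewrite ffunE k0 !eqxx.
have [_ eq2] := predecessorP cp k_gt0; apply/eqP => eq_x.
by move: eq2; rewrite eq_x => /eqP; rewrite -[X in _ == X]addn0 -addn1 eqn_add2l.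
Qed.

Lemma predecessor_inj : {in orbit_coding &, injective predecessor}.
Proof.
move=> p q cp cq eq_g.
suff eq_pq m x : (p.2 x < m)%N -> p.1 x = q.1 x /\ p.2 x = q.2 x :> nat.
  case: p q cp cq eq_g eq_pq => [r k] [r' k'] /= _ _ _ eq_pq.
  congr (_, _); apply/ffunP => x; have [e1 e2] := eq_pq _ x (ltnSn _) => //.
  exact: val_inj.
elim: m x => // m IHm x lt_km.
have [k0|k_gt0] := posnP (p.2 x).
  have q0 : q.2 x = 0 :> nat.
    by apply/eqP; rewrite -(predecessor_fix _ cq) -eq_g predecessor_fix ?k0.
  rewrite k0 q0; split=> //.
  have root u : orbit_coding u -> u.2 x = 0 :> nat -> u.1 x = x.
    move=> cu u0; have [e1 e2] := coding_root x cu.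
    by apply: (coding_inj cu); rewrite ?e2 ?u0.
  by rewrite !root.
have kq_gt0 : (0 < q.2 x)%N.
  by rewrite lt0n -(predecessor_fix _ cq) -eq_g predecessor_fix -?lt0n.
have [e1 e2] := predecessorP cp k_gt0; have [f1 f2] := predecessorP cq kq_gt0.
have [|h1 h2] := IHm (predecessor p x); first by rewrite -ltnS e2.
by rewrite -e1 -e2 -f1 -f2 -eq_g h1 h2.
Qed.

Lemma card_orbit_coding : (#|[set p | orbit_coding p]| <= n ^ n)%N.
Proof.
have <- : #|{ffun 'I_n -> 'I_n}| = (n ^ n)%N by rewrite card_ffun !card_ord.
rewrite -(@card_in_imset _ _ predecessor) ?max_card //.
by move=> p q; rewrite !inE => cp cq; apply: predecessor_inj.
Qed.

Lemma sum_card_block p : (\sum_rho #|block p rho|)%N = n.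
Proof.
rewrite -[RHS]card_ord -[RHS]sum1_card [RHS](partition_big p.1 predT) //=.
by apply: eq_bigr => rho _; rewrite sum1dep_card.
Qed.

End OrbitCoding.

Section ClassRepresentatives.
Local Open Scope group_scope.
Variables (n : nat) (A : {set {group {perm 'I_n}}}).

Definition class_repr (B : {set {set {perm 'I_n}}}) : {group {perm 'I_n}} :=
  odflt 1%G [pick H : {group {perm 'I_n}} in A | H :^: [set: {perm 'I_n}] == B].

Definition class_reprs := [set class_repr B | B in conj_classes A].

Lemma class_reprP (H : {group {perm 'I_n}}) : H \in A ->
  exists2 H' : {group {perm 'I_n}},
    H' \in A :&: class_reprs & exists u, H :=: H' :^ u.
Proof.
move=> AH; pose B : {set {set {perm 'I_n}}} := H :^: [set: {perm 'I_n}].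
have cB : B \in conj_classes A by apply: imset_f.
have [AH' eqB] : class_repr B \in A /\ class_repr B :^: [set: {perm 'I_n}] = B.
  rewrite /class_repr; case: pickP => [H' /andP[AH' /eqP] // | /(_ H)].
  by rewrite AH eqxx.
exists (class_repr B); first by rewrite in_setI AH'; apply: imset_f.
have /imsetP[u _ defH] : (H : {set _}) \in class_repr B :^: [set: {perm 'I_n}].
  by rewrite eqB; apply/imsetP; exists 1; rewrite ?inE ?conjsg1.
by exists u.
Qed.
End ClassRepresentatives.

Section OrbitEnumeration.
Local Open Scope group_scope.
Variables (P : group_pred) (CC : forall n : nat, {set {group {perm 'I_n}}}).
Arguments P : clear implicits.
Hypotheses (P_prop : group_theoretic P) (P_quo : quotient_closed P)
    (CC_cover : forall (n : nat) (G : {group {perm 'I_n}}),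
        (0 < n)%N -> transitive_group G -> P _ G ->
        exists2 H : {group {perm 'I_n}}, H \in CC n & G \subset H).

(* On no points the hypotheses say nothing about [CC], so the trivial group is used. *)
Definition reprs (m : nat) : {set {group {perm 'I_m}}} :=
  if m == 0 then [set 1%G] else CC m :&: class_reprs (CC m).

Variables (n : nat) (x0 : 'I_n) (G : {group {perm 'I_n}}).
Hypothesis PG : P _ G.

Definition good_enum (A : {set 'I_n}) (s : seq 'I_n) :=
  [/\ uniq s, s =i A & exists2 H, H \in reprs #|A| &
    {in G, forall g, pull (fun j : 'I_#|A| => nth x0 s j) g \in H}].

Lemma orbit_good_enum x : exists s, good_enum (orbit 'P G x) s.
Proof.
set A := orbit 'P G x; pose e : 'I_#|A| -> 'I_n := enum_val.
have inj_e : injective e := @enum_val_inj _ _.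
have Ax : x \in A := orbit_refl _ _ _.
have eA i : e i \in A := enum_valP i.
have A_e y : y \in A -> exists i, e i = y.
  by move=> Ay; exists (enum_rank_in Ax y); rewrite /e enum_rankK_in.
have orbit_e j : orbit 'P G (e j) = A.
  by apply/orbit_eqP.
have sGe : G \subset liftable e.
  apply/subsetP => g Gg; apply: liftable_codom => // j.
  have [|i <-] := A_e (g (e j)); last exact: codom_f.
  by have := mem_orbit 'P (e j) Gg; rewrite orbit_e.
pose X := (pull_morphism inj_e @* G)%G.
have m_gt0 : (0 < #|A|)%N by apply/card_gt0P; exists x.
have trX : transitive_group X.
  apply/imsetP; exists (enum_rank_in Ax x); rewrite ?inE //.
  apply/setP => j; rewrite inE; apply/esym.
  by rewrite -(mem_imset _ _ inj_e) -orbit_pull // orbit_e eA.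
have PX : P _ X by apply: P_morphim.
have [H0 CH0 sXH0] := CC_cover m_gt0 trX PX.
have [H rH [u def_H0]] := class_reprP CH0.
pose s := [seq e (u j) | j <- enum 'I_#|A|].
have nth_s (j : 'I_#|A|) : nth x0 s j = e (u j).
  by rewrite (nth_map j) ?size_enum_ord // nth_ord_enum.
exists s; split.
- by rewrite map_inj_uniq ?enum_uniq // => i j /inj_e/perm_inj.
- move=> y; apply/mapP/idP => [[j _ ->] //|/A_e[j <-]].
  by exists (u^-1 j); rewrite ?mem_enum ?permKV.
exists H; first by rewrite /reprs -[_ == _]negbK -lt0n m_gt0.
move=> g Gg; have lg := subsetP sGe g Gg.
rewrite (@pull_uniq _ _ _ _ (pull e g ^ u^-1)).
- have : pull e g \in H0 by apply: (subsetP sXH0); apply/morphimP; exists g.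
  by rewrite def_H0 mem_conjg.
- by move=> i j; rewrite !nth_s => /inj_e/perm_inj.
by move=> j; rewrite !nth_s conjgE invgK !permM permKV pullE.
Qed.

Definition codes (p : {ffun 'I_n -> 'I_n} * {ffun 'I_n -> 'I_n}) :=
  (forall x, orbit 'P G x = block p (p.1 x)) /\
  forall rho, exists2 H, H \in reprs #|block p rho| &
    {in G, forall g, pull (fun j : 'I_#|block p rho| => coding_point p rho j) g \in H}.

Lemma exists_code : exists2 p, orbit_coding p & codes p.
Proof.
have [s sP] : exists s : {set 'I_n} -> seq 'I_n,
    forall x, good_enum (orbit 'P G x) (s (orbit 'P G x)).
  suff: forall A, exists t, (exists x, A = orbit 'P G x) -> good_enum A t.
    by case/fin_all_exists => s sP; exists s => x; apply: sP; exists x.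
  move=> A; have [[x ->] | no_x] := pselect (exists x, A = orbit 'P G x).
    by have [t gt] := orbit_good_enum x; exists t.
  by exists [::].
pose A x := orbit 'P G x.
have s_uniq x : uniq (s (A x)) by case: (sP x).
have mem_s x : s (A x) =i A x by case: (sP x).
have size_s x : size (s (A x)) = #|A x|.
  by rewrite -(eq_card (mem_s x)); apply/esym/card_uniqP.
have Axx x : x \in A x := orbit_refl _ _ _.
have A_gt0 x : (0 < #|A x|)%N by apply/card_gt0P; exists x.
have eqA x y : y \in A x -> A y = A x by move/orbit_eqP.
have lt_index x : (index x (s (A x)) < n)%N.
  apply: (@leq_trans #|A x|); first by rewrite -size_s index_mem mem_s.
  by rewrite -[leqRHS]card_ord max_card.
pose p := ([ffun x => nth x0 (s (A x)) 0], [ffun x => Ordinal (lt_index x)]).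
have p1E x : p.1 x = nth x0 (s (A x)) 0 by rewrite ffunE.
have p2E x : p.2 x = index x (s (A x)) :> nat by rewrite ffunE.
have nth_A x j : (j < #|A x|)%N -> nth x0 (s (A x)) j \in A x.
  by move=> ltj; rewrite -mem_s mem_nth ?size_s.
have A_p1 x : A (p.1 x) = A x by apply: eqA; rewrite p1E nth_A.
have blockE x : block p (p.1 x) = A x.
  apply/setP => y; rewrite inE; apply/eqP/idP => [eqr | /eqA Ay].
    by rewrite -(A_p1 x) -eqr A_p1.
  by rewrite !p1E Ay.
have cp : orbit_coding p.
  apply/and3P; split.
  - apply/injectiveP => x y [e1 e2]; have Axy : A x = A y by rewrite -A_p1 e1 A_p1.
    have := congr1 val e2; rewrite /= !p2E Axy => e3.
    by rewrite -(nth_index x0 (_ : x \in s (A y))) ?e3 ?nth_index // mem_s // -Axy.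
  - by apply/forallP => x; rewrite blockE p2E -size_s index_mem mem_s.
  apply/forallP => x; have -> : p.1 (p.1 x) = p.1 x by rewrite p1E A_p1 -p1E.
  by rewrite eqxx p2E A_p1 p1E index_uniq ?size_s.
exists p => //; split=> [x|rho]; first by rewrite blockE.
have [[x def_rho] | no_x] := pselect (exists x, rho = p.1 x); last first.
  exists 1%G; last first.
    move=> g _; apply/set1P/permP => j; have := enum_valP j; rewrite inE => /eqP eq_rho.
    by case: no_x; exists (enum_val j).
  suff -> : #|block p rho| = 0 by rewrite /reprs eqxx inE.
  apply: eq_card0 => y; rewrite inE; apply/negP => /eqP eq_rho.
  by case: no_x; exists y.
rewrite def_rho blockE; have [_ _ [H rH HP]] := sP x; exists H => // g Gg.
rewrite (_ : (fun j => _) = (fun j : 'I_#|A x| => nth x0 (s (A x)) j)) ?HP //.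
apply/funext => j; set y := nth _ _ _.
have Ay : A y = A x by apply: eqA; apply: nth_A.
have <- : p.2 y = j :> nat by rewrite p2E Ay index_uniq ?size_s.
have <- : p.1 y = p.1 x by rewrite !p1E Ay.
exact: coding_pointE.
Qed.

End OrbitEnumeration.

Local Open Scope ring_scope.


Lemma card_le_cover (R : numDomainType) (T J : finType) (A : {set J})
    (F : J -> {set T}) (X : {set T}) (B : R) :
    (forall x, x \in X -> exists2 j, j \in A & x \in F j) ->
    (forall j, j \in A -> #|F j|%:R <= B) ->
  #|X|%:R <= #|A|%:R * B.
Proof.
move=> XF FB; apply: (@le_trans _ _ (\sum_(j in A) #|F j|)%:R).
  rewrite ler_nat; apply: (@leq_trans #|\bigcup_(j in A) F j|).
    by apply/subset_leq_card/subsetP => x /XF[j Aj Fx]; apply/bigcupP; exists j.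
  elim/big_rec2: _ => [|j m Y _ leYm]; first by rewrite cards0.
  by apply: leq_trans (leq_card_setU _ _) _; rewrite leq_add2l.
by rewrite natr_sum mulr_natl -sumr_const; apply: ler_sum.
Qed.

Section Counting.
Variables (R : realType) (eps : R) (P : group_pred)
    (delta gamma C : R) (CC : forall n : nat, {set {group {perm 'I_n}}})
    (f : nat -> R).
Arguments P : clear implicits.
Hypotheses (eps_gt0 : 0 < eps) (P_prop : group_theoretic P)
    (P_sub : subgroup_closed P) (P_quo : quotient_closed P)
    (delta_gt0 : 0 < delta)
    (CC_order : forall (n : nat) (H : {group {perm 'I_n}}),
        (0 < n)%N -> H \in CC n -> (#|H|%:R : R) <= 2 `^ (delta * n%:R))
    (CC_classes : forall n : nat,
        (0 < n)%N -> (#|conj_classes (CC n)|%:R : R) <= 2 `^ (gamma * n%:R))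
    (CC_cover : forall (n : nat) (G : {group {perm 'I_n}}),
        (0 < n)%N -> transitive_group G -> P _ G ->
        exists2 H : {group {perm 'I_n}}, H \in CC n & G \subset H)
    (d_bound : forall (n : nat) (G : {group {perm 'I_n}}),
        (1 <= n)%N -> P _ G ->
        (forall x : 'I_n, (1 < #|orbit 'P G x|)%N -> C <= #|orbit 'P G x|%:R) ->
        ('m(G)%g)%:R <= eps * n%:R / delta)
    (f_mono : forall m n : nat, (m <= n)%N -> f m <= f n)
    (f_bound : forall (n t : nat) (n_ : 'I_t -> nat)
        (H : forall i : 'I_t, {group {perm 'I_(n_ i)}}),
        (forall i, (0 < n_ i)%N) ->
        (forall i, (n_ i)%:R < C) ->
        n = (\sum_(i < t) n_ i)%N ->
        (forall i, H i \in CC (n_ i)) ->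
        (#|P_subgroups P (setXn_group H)|%:R : R) <= 2 `^ (eps * n%:R ^+ 2 + f n)).

Lemma card_reprs m : (#|reprs CC m|%:R : R) <= 2 `^ (gamma * m%:R).
Proof.
rewrite /reprs; case: eqP => [->|/eqP m_neq0]; first by rewrite cards1 mulr0 powRr0.
apply: le_trans (CC_classes _); rewrite ?lt0n // ler_nat.
exact: leq_trans (subset_leq_card (subsetIr _ _)) (leq_imset_card _ _).
Qed.

Section FixedCode.
Variables (n : nat) (p : {ffun 'I_n -> 'I_n} * {ffun 'I_n -> 'I_n}).
Hypothesis cp : orbit_coding p.

Let S rho := {group {perm 'I_#|block p rho|}}.
Let e rho := fun j : 'I_#|block p rho| => coding_point p rho j.

Definition coded_subgroups (c : {dffun forall rho, S rho}) : {set {group {perm 'I_n}}} :=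
  [set G : {group {perm 'I_n}} | `[< [/\ P _ G, forall x, orbit 'P G x = block p (p.1 x)
     & forall rho, {in G, forall g, pull (@e rho) g \in c rho}] >]].

Lemma card_coded_subgroups (c : {dffun forall rho, S rho}) :
    (forall rho, c rho \in reprs CC #|block p rho|) ->
  (#|coded_subgroups c|%:R : R) <= 2 `^ (eps * n%:R ^+ 2 + f n).
Proof.
move=> cR; pose I := {rho : 'I_n | p.1 rho == rho}.
have lab_root x : p.1 (p.1 x) == p.1 x by rewrite (coding_root x cp).1.
pose lab x : I := exist _ (p.1 x) (lab_root x).
have eP rho j : p.1 (@e rho j) = rho /\ p.2 (@e rho j) = j :> nat.
  by apply: coding_pointP.
have block_gt0 (i : I) : (0 < #|block p (val i)|)%N.
  by apply/card_gt0P; exists (val i); rewrite inE; case: i.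
apply: (card_fixed_blocks (e := fun i : I => @e (val i)) (lab := lab)
  (H := fun i : I => c (val i)) eps_gt0 P_prop P_sub P_quo delta_gt0 CC_order d_bound f_mono f_bound).
- move=> i j k eq_e; apply: val_inj; rewrite -[LHS](eP (val i) j).2 /= eq_e.
  exact: (eP _ _).2.
- by move=> i y; apply: val_inj; rewrite /= (eP _ _).1.
- move=> x; exists (Ordinal (coding_lt x cp)); exact: coding_pointE.
- by move=> i; apply: block_gt0.
- move=> i; have := cR (val i); rewrite /reprs eqn0Ngt block_gt0 /=.
  by case/setIP.
- by move=> G; rewrite inE => /asboolP[].
- move=> G; rewrite inE => /asboolP[_ oG _] x; rewrite oG.
  by apply/setP => y; rewrite !inE -val_eqE.
by move=> G; rewrite inE => /asboolP[_ _ HG] i; apply: HG.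
Qed.

Lemma card_codes :
  (#|[set G : {group {perm 'I_n}} | `[< P _ G /\ codes CC G p >]]|%:R : R)
   <= 2 `^ (gamma * n%:R + (eps * n%:R ^+ 2 + f n)).
Proof.
pose A := setXn (fun rho => reprs CC #|block p rho|).
apply: (@le_trans _ _ (#|A|%:R * 2 `^ (eps * n%:R ^+ 2 + f n))).
  apply: (card_le_cover (F := coded_subgroups)) => [G|c /setXnP cR]; last first.
    exact: card_coded_subgroups.
  rewrite inE => /asboolP[PG [oG /fin_all_exists2[c cR cG]]].
  exists [ffun rho => c rho]; first by apply/setXnP => rho; rewrite ffunE; apply: cR.
  by rewrite inE; apply/asboolP; split=> // rho; rewrite ffunE; apply: cG.
rewrite [leRHS]pow2D ler_wpM2r ?powR_ge0 // cardsXn natr_prod.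
rewrite -[X in 2 `^ (_ * X%:R)](sum_card_block p) natr_sum mulr_sumr -pow2_prod.
by apply: ler_prod => rho _; rewrite ler0n card_reprs.
Qed.
End FixedCode.

Lemma card_P_subgroups_Sym n : (0 < n)%N ->
  (#|P_subgroups P [set: {perm 'I_n}]%G|%:R : R)
    <= n%:R ^+ n * 2 `^ (gamma * n%:R + (eps * n%:R ^+ 2 + f n)).
Proof.
move=> n_gt0.
apply: (@le_trans _ _ (#|[set p | @orbit_coding n p]|%:R
    * 2 `^ (gamma * n%:R + (eps * n%:R ^+ 2 + f n)))).
  apply: (card_le_cover
    (F := fun p => [set G : {group {perm 'I_n}} | `[< P _ G /\ codes CC G p >]])).
    move=> G; rewrite inE subsetT => /asboolP PG.
    have [p cp codp] := exists_code P_prop P_quo CC_cover (Ordinal n_gt0) PG.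
    by exists p; rewrite inE //; apply/asboolP.
  by move=> p; rewrite inE; apply: card_codes.
by rewrite ler_wpM2r ?powR_ge0 // -natrX ler_nat card_orbit_coding.
Qed.

Lemma gamma_ge0 : 0 <= gamma.
Proof.
have [_ P1] := P_prop.
have [|H CH _] := CC_cover (ltn0Sn 0) _ (P1 {perm 'I_1}).
  apply/imsetP; exists ord0 => //; apply/setP => x.
  by rewrite inE [x]ord1 orbit_refl.
have: (1 : R) <= 2 `^ (gamma * 1%:R).
  apply: le_trans (CC_classes (ltn0Sn 0)); rewrite ler1n card_gt0.
  by apply/set0Pn; exists (H :^: setT)%g; apply: imset_f.
by move/ln_ge0; rewrite mulr1 ln_powR pmulr_lge0 // ln_gt0 // ltr1n.
Qed.

End Counting.
Theorem theorem6p4 (R : realType) (eps : R) (P : group_pred)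
    (delta gamma C : R) (CC : forall n : nat, {set {group {perm 'I_n}}})
    (f : nat -> R)
    (eps_gt0 : 0 < eps)
    (P_prop : group_theoretic P)
    (* (i) *)
    (P_sub : subgroup_closed P)
    (P_quo : quotient_closed P)
    (* (ii) *)
    (delta_gt0 : 0 < delta)
    (CC_trans : forall (n : nat) (H : {group {perm 'I_n}}),
        (0 < n)%N -> H \in CC n -> transitive_group H)
    (CC_order : forall (n : nat) (H : {group {perm 'I_n}}),
        (0 < n)%N -> H \in CC n -> (#|H|%:R : R) <= 2 `^ (delta * n%:R))
    (CC_classes : forall n : nat,
        (0 < n)%N -> (#|conj_classes (CC n)|%:R : R) <= 2 `^ (gamma * n%:R))
    (CC_cover : forall (n : nat) (G : {group {perm 'I_n}}),
        (0 < n)%N -> transitive_group G -> P _ G ->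
        exists2 H : {group {perm 'I_n}}, H \in CC n & G \subset H)
    (* (iii) *)
    (d_bound : forall (n : nat) (G : {group {perm 'I_n}}),
        (1 <= n)%N -> P _ G ->
        (forall x : 'I_n, (1 < #|orbit 'P G x|)%N -> C <= #|orbit 'P G x|%:R) ->
        ('m(G)%g)%:R <= eps * n%:R / delta)
    (f_ge0 : forall n : nat, 0 <= f n)
    (f_mono : forall m n : nat, (m <= n)%N -> f m <= f n)
    (f_bound : forall (n t : nat) (n_ : 'I_t -> nat)
        (H : forall i : 'I_t, {group {perm 'I_(n_ i)}}),
        (forall i, (0 < n_ i)%N) ->
        (forall i, (n_ i)%:R < C) ->
        n = (\sum_(i < t) n_ i)%N ->
        (forall i, H i \in CC (n_ i)) ->
        (#|P_subgroups P (setXn_group H)|%:R : R) <= 2 `^ (eps * n%:R ^+ 2 + f n)) :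
  forall n : nat, (2 <= n)%N ->
    (#|P_subgroups P [set: {perm 'I_n}]%G|%:R : R)
      <= 2 `^ (eps * n%:R ^+ 2 + f n + n%:R * log2 n%:R + gamma * n%:R
               + 4 * Num.sqrt n%:R)
    /\ 2 `^ (eps * n%:R ^+ 2 + f n + n%:R * log2 n%:R + gamma * n%:R
             + 4 * Num.sqrt n%:R)
      <= 2 `^ (eps * n%:R ^+ 2 + f n + (5 + gamma) * n%:R * log2 n%:R) :> R.
Proof.
move=> n n_ge2; have n_gt0 : (0 < n)%N := ltnW n_ge2.
have n_gt0R : (0 : R) < n%:R by rewrite ltr0n.
have ln2_gt0 : 0 < ln (2 : R) by rewrite ln_gt0 // ltr1n.
have log_ge1 : 1 <= log2 (n%:R : R).
  by rewrite /log2 ler_pdivlMr // mul1r ler_ln ?posrE ?ler_nat.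
have pow_n : n%:R ^+ n = 2 `^ (n%:R * log2 n%:R) :> R.
  rewrite -[LHS]powR_mulrn ?ler0n //.
  by rewrite /powR !gt_eqF // /log2 -mulrA divfK ?gt_eqF.
have gamma0 := gamma_ge0 P_prop CC_classes CC_cover.
split.
  apply: le_trans (card_P_subgroups_Sym eps_gt0 P_prop P_sub P_quo delta_gt0 CC_order
    CC_classes CC_cover d_bound f_mono f_bound n_gt0) _.
  rewrite pow_n -pow2D; apply: ler_pow2.
  have := sqrtr_ge0 (n%:R : R); lra.
have sqrt_le : Num.sqrt (n%:R : R) <= n%:R * log2 n%:R.
  apply: (@le_trans _ _ n%:R); last by rewrite ler_peMr // ltW.
  by rewrite -[leRHS]ger0_norm ?ler0n // -sqrtr_sqr ler_wsqrtr // ler_eXnr // ler1n.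
have gamma_le : gamma * n%:R <= gamma * n%:R * log2 n%:R.
  by rewrite ler_peMr // mulr_ge0 ?ler0n.
by apply: ler_pow2; lra.
Qed.
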